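(* Let $G$ be a finite group such that the enhanced power graph $\mathcal{E}(G)$ is a cograph. Then $\mathcal{E}(G)$ is chordal.
   Context: All graphs are finite, undirected and simple. The enhanced power graph $\mathcal{E}(G)$ of a group $G$ is the graph with vertex set $G$ in which $\{x,y\}$ is an edge if and only if $x\neq y$ and $\langle x,y\rangle$ is cyclic. For a graph $\Delta$, a graph is $\Delta$-free if it has no induced subgraph isomorphic to $\Delta$. $P_4$ is the path with four vertices and $C_n$ is the cycle with $n$ vertices. A graph is a cograph if it is $P_4$-free; it is chordal if it is $C_n$-free for every $n\geq 4$. *)

(* Defs.v *)
From HB Require Import structures.
From mathcomp Require Import all_boot all_fingroup all_solvable.

Set Implicit Arguments.
Unset Strict Implicit.
Unset Printing Implicit Defensive.

Record sgraph := SGraph {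
  vertex :> finType;
  edge : rel vertex;
  edge_sym : symmetric edge;
  edge_irrefl : irreflexive edge }.

Definition isomorphic (A B : sgraph) : Prop :=
  exists2 f : A -> B, bijective f & {mono f : x y / edge x y}.

Section Induced.
Variables (A : sgraph) (S : {set A}).

Definition induced_edge : rel {x : A | x \in S} :=
  fun x y => edge (val x) (val y).

Lemma induced_edge_sym : symmetric induced_edge.
Proof. by move=> x y; apply: edge_sym. Qed.

Lemma induced_edge_irrefl : irreflexive induced_edge.
Proof. by move=> x; apply: edge_irrefl. Qed.

Definition induced : sgraph := SGraph induced_edge_sym induced_edge_irrefl.
End Induced.

Definition graph_free (D A : sgraph) : Prop :=
  ~ exists S : {set A}, isomorphic (induced S) D.

Definition path_edge n : rel 'I_n :=
  fun i j => (i.+1 == j :> nat) || (j.+1 == i :> nat).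

Lemma path_edge_sym n : symmetric (@path_edge n).
Proof. by move=> i j; rewrite /path_edge orbC. Qed.

Lemma path_edge_irrefl n : irreflexive (@path_edge n).
Proof. by move=> i; rewrite /path_edge orbb gtn_eqF. Qed.

Definition path_graph n : sgraph :=
  SGraph (@path_edge_sym n) (@path_edge_irrefl n).

(* The condition i != j only matters for n = 1, where ordS has a fixed point;
   the result is the n-cycle for n >= 3. *)
Definition cycle_edge n : rel 'I_n :=
  fun i j => (i != j) && ((ordS i == j) || (ordS j == i)).

Lemma cycle_edge_sym n : symmetric (@cycle_edge n).
Proof. by move=> i j; rewrite /cycle_edge eq_sym orbC. Qed.

Lemma cycle_edge_irrefl n : irreflexive (@cycle_edge n).
Proof. by move=> i; rewrite /cycle_edge eqxx. Qed.

Definition cycle_graph n : sgraph :=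
  SGraph (@cycle_edge_sym n) (@cycle_edge_irrefl n).

Definition cograph (A : sgraph) : Prop := graph_free (path_graph 4) A.

Definition chordal (A : sgraph) : Prop :=
  forall n : nat, 4 <= n -> graph_free (cycle_graph n) A.

Section EnhancedPowerGraph.
Variables (gT : finGroupType) (G : {group gT}).

Definition epg_edge : rel [subg G] :=
  fun x y => (x != y) && cyclic <<[set sgval x; sgval y]>>%g.

Lemma epg_edge_sym : symmetric epg_edge.
Proof. by move=> x y; rewrite /epg_edge eq_sym setUC. Qed.

Lemma epg_edge_irrefl : irreflexive epg_edge.
Proof. by move=> x; rewrite /epg_edge eqxx. Qed.

Definition enhanced_power_graph : sgraph :=
  SGraph epg_edge_sym epg_edge_irrefl.
End EnhancedPowerGraph.

(* Main.v *)
Require Import Defs.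
From mathcomp Require Import all_boot all_fingroup all_solvable.

(** The proof rests on the following observation.  Let [a], [b], [c], [d] be
    elements of [G] such that the pairs [a b], [b c], [c d] generate cyclic
    groups while [a c] and [b d] do not; the pair [a d] is arbitrary.  Choose
    generators [u] of <<a, b>> and [w] of <<c, d>>.  Then [u - b - c - w] is an
    induced path of the enhanced power graph: a cyclic group containing [u]
    contains [a] and [b], and one containing [w] contains [c] and [d], so any of
    the chords [u c], [u w], [b w] would put [a] and [c], or [b] and [d], in a
    common cyclic group.  Replacing the end points [a] and [d] by generators is
    what removes the possible chord [a d].

    Four consecutive vertices of an induced cycle of length at least 4 are in
    this situation (with [a d] an edge exactly when the length is 4), so every
    such cycle forces an induced [P_4], whatever its length. *)

Set Implicit Arguments.
Unset Strict Implicit.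
Unset Printing Implicit Defensive.

(** Edge-reflecting injections are easier to build and to use than
    isomorphisms from the subgraph induced on a set of vertices. *)
Lemma induced_isomorphicP (D A : sgraph) :
  (exists S : {set A}, isomorphic (induced S) D) <->
  (exists2 g : D -> A, injective g & {mono g : x y / edge x y}).
Proof.
split=> [[S [f [g fK gK] f_mono]] | [g g_inj g_mono]].
  exists (val \o g) => [|x y]; first exact: inj_comp val_inj (can_inj gK).
  by rewrite -[in RHS](gK x) -[in RHS](gK y) f_mono.
pose h y : induced (g @: D) := Sub (g y) (imset_f g (isT : y \in D)).
have h_inj : injective h by move=> x y /(congr1 val) /g_inj.
have card_le : #|induced (g @: D)| <= #|D|.
  by rewrite card_sig leq_imset_card.
have [f hK fK] := inj_card_bij h_inj card_le.
exists (g @: D); exists f; first by exists h.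
by move=> x y; rewrite -g_mono -[in RHS](fK x) -[in RHS](fK y).
Qed.

(** Injectivity comes for free: distinct vertices of [P_4] have distinct
    neighbourhoods. *)
Lemma path4_mono_inj (A : sgraph) (g : path_graph 4 -> A) :
  {mono g : x y / edge x y} -> injective g.
Proof.
move=> g_mono x y eq_g.
have nbr z : edge x z = edge y z by rewrite -!g_mono eq_g.
have := (nbr (inord 0), nbr (inord 1), nbr (inord 2), nbr (inord 3)).
apply: contraPeq; rewrite /= /path_edge !inordK // -val_eqE.
by case: x y {eq_g nbr} => [[|[|[|[|//]]]] ?] [[|[|[|[|//]]]] ?] //= _ [[[]]].
Qed.

Lemma path4_not_cograph (A : sgraph) (p q r s : A) :
    edge p q -> edge q r -> edge r s ->
    ~~ edge p r -> ~~ edge p s -> ~~ edge q s ->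
  ~ cograph A.
Proof.
move=> pq qr rs /negPf pr /negPf ps /negPf qs; apply.
apply/induced_isomorphicP.
pose g (i : path_graph 4) := tnth [tuple p; q; r; s] i.
suff g_mono : {mono g : x y / edge x y} by exists g => //; exact: path4_mono_inj.
move=> [[|[|[|[|//]]]] ?] [[|[|[|[|//]]]] ?]; rewrite /g !(tnth_nth p) /=;
  by rewrite ?edge_irrefl // ?(pq, qr, rs, pr, ps, qs) // edge_sym
             ?(pq, qr, rs, pr, ps, qs).
Qed.

Lemma cycle_graph4 n (A : sgraph) (g : cycle_graph n -> A) :
    4 <= n -> {mono g : x y / edge x y} -> injective g ->
  exists a b c d : A, [/\ edge a b, edge b c & edge c d] /\
    [/\ a != c, b != d, ~~ edge a c & ~~ edge b d].
Proof.
case: n g => [|[|[|[|m]]]] // g _ g_mono g_inj.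
have lt4 k : k < 4 -> k < m.+4 by move/leq_trans; apply.
exists (g (Ordinal (lt4 0 isT))), (g (Ordinal (lt4 1 isT))).
exists (g (Ordinal (lt4 2 isT))), (g (Ordinal (lt4 3 isT))).
rewrite !g_mono !(inj_eq g_inj) /= /cycle_edge -!val_eqE /=.
(* The successor of vertex 3 is 0 or 4 according to the length of the cycle. *)
by case: m {lt4 g g_mono g_inj} => // m; rewrite !modn_small.
Qed.

Section EnhancedPowerGraph.
Import GroupScope.
Variables (gT : finGroupType) (G : {group gT}).
Implicit Types x y u w : [subg G].

(** Without the condition [x != y] of [epg_edge] the relation is inherited by
    elements of the cyclic subgroups generated by two related elements. *)
Definition cocyclic x y := cyclic <<[set sgval x; sgval y]>>.

Lemma cocyclic_sub x y u w :
    sgval x \in <[sgval u]> -> sgval y \in <[sgval w]> ->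
  cocyclic u w -> cocyclic x y.
Proof.
move=> xu yw; apply: cyclicS; rewrite gen_subG subUset !sub1set.
have sub z : z \in [set sgval u; sgval w] ->
    <[z]> \subset <<[set sgval u; sgval w]>>.
  by move=> zS; rewrite cycle_subG mem_gen.
by rewrite (subsetP (sub _ (set21 _ _))) // (subsetP (sub _ (set22 _ _))).
Qed.

Lemma cocyclic_cycle u x : sgval x \in <[sgval u]> -> cocyclic u x.
Proof.
move=> xu; apply: cyclicS (cycle_cyclic (sgval u)).
by rewrite gen_subG subUset !sub1set cycle_id.
Qed.

Lemma cocyclicC x y : cocyclic x y = cocyclic y x.
Proof. by rewrite /cocyclic setUC. Qed.

Lemma cocyclic_generator x y : cocyclic x y ->
  exists2 u : [subg G], sgval x \in <[sgval u]> & sgval y \in <[sgval u]>.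
Proof.
case/cyclicP=> z defz.
have zG : z \in G.
  rewrite -cycle_subG -defz gen_subG.
  by apply/subsetP=> _ /set2P[] ->; exact: subgP.
by exists (subg G z); rewrite subgK // -defz mem_gen // ?set21 ?set22.
Qed.

(** Non-adjacency on the path [u - b - c - w] also gives the inequalities its
    edges require: [u] and [b] differ because [c] is cocyclic with [b] only, and
    symmetrically for [c] and [w]. *)
Lemma cocyclic_chain_not_cograph a b c d :
    cocyclic a b -> cocyclic b c -> cocyclic c d ->
    ~~ cocyclic a c -> ~~ cocyclic b d ->
  ~ cograph (enhanced_power_graph G).
Proof.
move=> ab bc cd nac nbd.
have [u au bu] := cocyclic_generator ab.
have [w cw dw] := cocyclic_generator cd.
have nuc : ~~ cocyclic u c.
  by apply: contra nac; apply: cocyclic_sub; rewrite ?cycle_id.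
have nuw : ~~ cocyclic u w by apply: contra nac; apply: cocyclic_sub.
have nbw : ~~ cocyclic b w.
  by apply: contra nbd; apply: cocyclic_sub; rewrite ?cycle_id.
have edgeP x y : epg_edge x y = (x != y) && cocyclic x y by [].
apply: (@path4_not_cograph (enhanced_power_graph G) u b c w) => /=;
  rewrite edgeP ?negb_and ?nuc ?nuw ?nbw ?orbT //.
- rewrite cocyclic_cycle // andbT.
  by apply: contraNneq nuc => ->.
- rewrite bc andbT.
  by apply: contraNneq nac => <-.
rewrite cocyclicC cocyclic_cycle // andbT.
by apply: contraNneq nbw => <-.
Qed.

End EnhancedPowerGraph.

Theorem theoremA (gT : finGroupType) (G : {group gT})
    (hG : cograph (enhanced_power_graph G)) :
  chordal (enhanced_power_graph G).
Proof.
move=> n n_ge4 /induced_isomorphicP[g g_inj g_mono].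
have [a [b [c [d [[ab bc cd] [a'c b'd nac nbd]]]]]] :=
  cycle_graph4 n_ge4 g_mono g_inj.
have edge_cocyclic x y : edge (s := enhanced_power_graph G) x y -> cocyclic x y.
  by case/andP.
apply: (@cocyclic_chain_not_cograph _ G a b c d) hG;
  try exact: edge_cocyclic.
  by apply: contra nac => ac; apply/andP.
by apply: contra nbd => bd; apply/andP.
Qed.
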